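(* Let $S$ be a Coe-semigroup and let $x$ be an even element of $S\setminus\{0\}$. Then $S_x=(\{x\}+S)\cup\{0\}$ is a Coe-semigroup with maximal embedding dimension. Moreover, every Coe-semigroup with maximal embedding dimension and distinct from $\mathbb{N}$ is of this form, i.e. equals $(\{x\}+S)\cup\{0\}$ for some Coe-semigroup $S$ and some even $x\in S\setminus\{0\}$.
   Context: $\mathbb{N}=\{0,1,2,\ldots\}$. A numerical semigroup is a subset of $\mathbb{N}$ containing $0$, closed under addition and with finite complement in $\mathbb{N}$. A numerical semigroup $S$ is a Coe-semigroup if $\{x-1,x+1\}\subseteq S$ for every odd $x\in S$. The multiplicity of $S$ is $m(S)=\min(S\setminus\{0\})$; the embedding dimension $e(S)$ is the cardinality of the (unique, finite) minimal system of generators of $S$ as a submonoid of $(\mathbb{N},+)$. $S$ has maximal embedding dimension if $e(S)=m(S)$. For sets of integers, $A+B=\{a+b\mid a\in A,\ b\in B\}$. *)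

(* Defs.v *)
From mathcomp Require Import all_boot all_order.
From mathcomp Require Import finmap.
From mathcomp Require Import boolp classical_sets functions cardinality.

Set Implicit Arguments.
Unset Strict Implicit.
Unset Printing Implicit Defensive.

Local Open Scope classical_set_scope.
Local Open Scope nat_scope.

Definition sumset (A B : set nat) : set nat := [set a + b | a in A & b in B].

Definition submonoid (S : set nat) : Prop :=
  S 0 /\ (forall a b, S a -> S b -> S (a + b)).

Definition numerical_semigroup (S : set nat) : Prop :=
  submonoid S /\ finite_set (~` S).

(* Truncated subtraction is harmless here: an odd x is at least 1. *)
Definition coe_semigroup (S : set nat) : Prop :=
  numerical_semigroup S /\
  (forall x, odd x -> S x -> [set x - 1; x + 1] `<=` S).

(* The least element of S \ {0}; the default 0 is returned only when
   S \ {0} is empty, which never happens for a numerical semigroup. *)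
Definition multiplicity (S : set nat) : nat :=
  xget 0 ((S `\ 0) `&` lbound (S `\ 0)).

Definition generates (A S : set nat) : Prop := smallest submonoid A = S.

Definition minimal_generators (S A : set nat) : Prop :=
  generates A S /\ (forall B, B `<` A -> ~ generates B S).

(* A numerical semigroup has exactly one minimal system of generators, and it
   is finite, so neither the default set0 of xget nor the value fset0 of
   fset_set on infinite sets is used. *)
Definition embedding_dimension (S : set nat) : nat :=
  #|` fset_set (xget set0 (minimal_generators S))|%fset.

Definition maximal_embedding_dimension (S : set nat) : Prop :=
  embedding_dimension S = multiplicity S.

(* Main.v *)
(** For a numerical semigroup T of multiplicity m, the minimal generators are the
    irreducible elements, i.e. the positive elements that are not sums of two
    positive elements. An irreducible element is the least positive element of
    its class modulo m, so there are at most m of them, and T has maximal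
    embedding dimension iff every class modulo m contains one. For T = (x + S) with
    0 added, m = x, and the least positive element of each class is irreducible,
    since x can be subtracted from any sum of two positive elements. Conversely,
    if every class contains an irreducible, then s + t - m is in T for all positive
    s, t in T, which says that (T \ {0}) - m is closed under addition; m is even
    because otherwise m - 1 would be an element of T, forcing m = 1. *)
Require Import Defs.
From mathcomp Require Import all_boot all_order.
From mathcomp Require Import finmap.
From mathcomp Require Import boolp classical_sets functions cardinality.
From mathcomp Require Import zify.

Local Open Scope classical_set_scope.
Local Open Scope nat_scope.

(** * Irreducible elements as the minimal generators *)

Definition irreducibles (T : set nat) : set nat :=
  (T `\ 0) `\` sumset (T `\ 0) (T `\ 0).

Lemma irreducible_summand (T : set nat) (a b : nat) :
  irreducibles T (a + b) -> T a -> T b -> a = 0 \/ b = 0.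
Proof.
move=> [_ irr] Ta Tb; apply: contrapT => /not_orP[a0 b0].
by apply: irr; exists a => //; exists b.
Qed.

Lemma irreducibles_generate (T : set nat) :
  submonoid T -> generates (irreducibles T) T.
Proof.
move=> mT; apply/seteqP; split.
  by apply: smallest_sub => // a [[]].
move=> n; elim/ltn_ind: n => n IHn Tn B [[B0 BD] irrB].
have [->//|n0] := eqVneq n 0.
have [|red] := pselect (sumset (T `\ 0) (T `\ 0) n).
  move=> [a [Ta /eqP a0]] [b [Tb /eqP b0]] nE; subst n.
  have smallB c : smallest submonoid (irreducibles T) c -> B c by apply.
  by apply: BD; apply: smallB; apply: IHn => //; lia.
by apply: irrB; split=> //; split=> //; apply/eqP.
Qed.

(** Removing an irreducible [a] from [T] leaves a submonoid; if [A] missed [a], this smaller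
    submonoid would contain [A], hence all of [T]. *)
Lemma irreducibles_sub_generators (T A : set nat) :
  generates A T -> irreducibles T `<=` A.
Proof.
move=> genA a irr_a; apply: contrapT => nAa.
have subAT : A `<=` T by rewrite -genA; apply: sub_gen_smallest.
have [[Ta a0] _] := irr_a.
have [T0 TD] : submonoid T.
  rewrite -genA; split=> [B [[]]//|x y Ax Ay B BA].
  by have [[_ BD] _] := BA; apply: BD; [apply: Ax|apply: Ay].
suff /(_ _ Ta)[_ /(_ erefl)] : T `<=` T `\ a by [].
rewrite -{1}genA; apply: smallest_sub; last first.
  by move=> b Ab; split; [apply: subAT|move=> /= ba; apply: nAa; rewrite -ba].
split; first by split=> // /= a0'; apply: a0; rewrite /= -a0'.
move=> x y [Tx xa] [Ty ya]; split=> [|/= xyE]; first exact: TD.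
rewrite -xyE in irr_a; have [x0|y0] := irreducible_summand _ _ _ irr_a Tx Ty.
  by apply: ya; rewrite /= -xyE x0.
by apply: xa; rewrite /= -xyE y0 addn0.
Qed.

Lemma minimal_generators_irreducibles (T : set nat) :
  submonoid T -> xget set0 (minimal_generators T) = irreducibles T.
Proof.
move=> mT; apply: xget_unique.
  split; first exact: irreducibles_generate.
  by move=> B [BI nIB] /irreducibles_sub_generators.
move=> A [genA minA]; apply: contrapT => AI; apply: (minA (irreducibles T)).
  have sIA := irreducibles_sub_generators _ _ genA.
  by split=> // sAI; apply: AI; apply/seteqP.
exact: irreducibles_generate.
Qed.

(** * Multiplicity and residue classes *)

Lemma multiplicity_eq (T : set nat) (m : nat) :
  (T `\ 0) m -> (forall a, (T `\ 0) a -> m <= a) -> multiplicity T = m.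
Proof.
move=> Tm lb; apply: xget_unique; first by split=> // a /lb; rewrite leEnat.
move=> a [Ta /(_ _ Tm)]; rewrite leEnat => am.
by apply/eqP; rewrite eqn_leq am lb.
Qed.

Lemma cofinite_nat (T : set nat) :
  finite_set (~` T) -> exists N, forall n, N <= n -> T n.
Proof.
move=> finT; exists (\max_(i <- fset_set (~` T)) i).+1 => n.
apply: contraPP => nTn.
have : n \in fset_set (~` T) by rewrite in_fset_set // inE.
by move=> /(leq_bigmax_seq (F := id)) /(_ erefl) /=; lia.
Qed.

(** Cofiniteness provides a positive element, so a least one exists and [xget] does not fall back on
    0. *)
Lemma multiplicity_spec (T : set nat) : numerical_semigroup T ->
  (T `\ 0) (multiplicity T) /\ forall a, (T `\ 0) a -> multiplicity T <= a.
Proof.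
move=> [_ /cofinite_nat[N TN]].
have exm : exists a, `[< (T `\ 0) a >].
  by exists N.+1; apply/asboolP; split=> //; apply: TN.
have [m /asboolP Tm lb] := ex_minnP exm.
have lb' a : (T `\ 0) a -> m <= a by move=> ?; apply/lb/asboolP.
by rewrite (multiplicity_eq _ _ Tm lb').
Qed.

Lemma eqn_mod_leq_ex (m a b : nat) :
  a <= b -> a = b %[mod m] -> exists k, b = a + k * m.
Proof.
move=> ab /esym/eqP; rewrite eqn_mod_dvd // => /dvdnP[k kE].
by exists k; rewrite -kE subnKC.
Qed.

Lemma submonoid_muln (T : set nat) (k m : nat) :
  submonoid T -> T m -> T (k * m).
Proof.
by move=> [T0 TD] Tm; elim: k => // k IHk; rewrite mulSn; apply: TD.
Qed.

(** If [b < a], then [a = b + k * m] with [k > 0] splits [a] into two positive elements of [T]. *)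
Lemma irreducible_mod_leq (T : set nat) (m a b : nat) :
    submonoid T -> (T `\ 0) m -> irreducibles T a -> (T `\ 0) b ->
  a = b %[mod m] -> a <= b.
Proof.
move=> mT [Tm _] irr_a [Tb b0] abm; rewrite leqNgt; apply/negP => ba.
have [k aE] := eqn_mod_leq_ex _ _ _ (ltnW ba) (esym abm); subst a.
have Tkm := submonoid_muln _ k _ mT Tm.
by have [|km0] := irreducible_summand _ _ _ irr_a Tb Tkm => //; lia.
Qed.

Lemma irreducibles_mod_inj (T : set nat) (m : nat) :
    submonoid T -> (T `\ 0) m ->
  {in irreducibles T &, injective (modn^~ m)}.
Proof.
move=> mT Tm a b; rewrite !inE => irr_a irr_b abm; apply/eqP.
rewrite eqn_leq (irreducible_mod_leq T m) ?(irreducible_mod_leq T m b a) //.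
- by case: irr_a.
- by case: irr_b.
Qed.

(** Reduction modulo [m] injects the irreducibles into the [m] residues, so counting [m] of them
    amounts to surjectivity. *)
Lemma maximal_embedding_dimensionP (T : set nat) (m : nat) :
    submonoid T -> (T `\ 0) m -> multiplicity T = m ->
  maximal_embedding_dimension T <->
  (forall r, r < m -> exists2 a, irreducibles T a & a %% m = r).
Proof.
move=> mT Tm multT; have inj := irreducibles_mod_inj _ _ mT Tm.
have m_gt0 : 0 < m by case: Tm => _ /= /eqP; lia.
(* Finiteness makes [fset_set] faithful; it is pulled back from the residues along the injection. *)
have finI : finite_set (irreducibles T).
  rewrite -(eq_finite_set (inj_card_eq inj)).
  by apply: sub_finite_set (finite_II m) => _ [a _ <-] /=; rewrite ltn_mod.
rewrite /maximal_embedding_dimension /embedding_dimension multT.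
rewrite minimal_generators_irreducibles //.
set I := fset_set (irreducibles T).
have memI a : a \in I = (a \in irreducibles T) by rewrite in_fset_set.
pose s := [seq a %% m | a <- I].
have uniq_s : uniq s.
  by rewrite map_inj_in_uniq ?fset_uniq // => a b; rewrite !memI; apply: inj.
have sub_s : {subset s <= iota 0 m}.
  by move=> _ /mapP[a _ ->]; rewrite mem_iota /= ltn_mod.
have -> : #|` I|%fset = size s by rewrite size_map.
split=> [size_s r rm|surj].
  have : r \in s.
    by rewrite (uniq_min_size uniq_s sub_s) ?mem_iota ?size_iota ?size_s.
  by move=> /mapP[a]; rewrite memI inE => Ia ->; exists a.
apply/eqP; rewrite eqn_leq -{1}(size_iota 0 m) uniq_leq_size //=.
rewrite -[X in X <= _](size_iota 0 m) uniq_leq_size ?iota_uniq // => r.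
rewrite mem_iota /= => /surj[a Ia <-].
by apply/mapP; exists a => //; rewrite memI inE.
Qed.

(** * Translates of a Coe-semigroup *)

Section Translate.
Variables (S : set nat) (x : nat).
Hypotheses (coeS : coe_semigroup S) (Sx : (S `\ 0) x) (x_even : ~~ odd x).

Let T := sumset [set x] S `|` [set 0].

Let x_gt0 : 0 < x.
Proof. by case: Sx => _ /= /eqP; lia. Qed.

Let T_translate n : S n -> T (x + n).
Proof. by move=> Sn; left; exists x => //; exists n. Qed.

Let T_positive n : (T `\ 0) n -> exists2 s, S s & n = x + s.
Proof. by move=> [[[_ -> [s Ss <-]]|//] _]; exists s. Qed.

Lemma translate_coe_semigroup : coe_semigroup T.
Proof.
have [[[S0 SD] finS] coe] := coeS; have [Sx' _] := Sx; split; first split.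
- split=> [|a b]; first by right.
  move=> [[_ -> [s Ss <-]]|->]; last by rewrite add0n.
  move=> [[_ -> [t St <-]]|->]; last by rewrite addn0; apply: T_translate.
  (* The sum is [x + (s + (x + t))]; the inner [x] is absorbed because [x] lies in [S]. *)
  by rewrite -addnA; apply/T_translate/(SD _ _ Ss)/SD.
- have [N SN] := cofinite_nat _ finS.
  apply: sub_finite_set (finite_II (x + N)) => n /= nTn; rewrite ltnNge.
  apply/negP => xNn; apply: nTn; rewrite -(@subnKC x n); last by lia.
  by apply: T_translate; apply: SN; lia.
- move=> n odd_n Tn y; have [|s Ss nE] := T_positive n.
    by split=> //= n0; move: odd_n; rewrite n0.
  have odd_s : odd s by move: odd_n; rewrite nE oddD (negbTE x_even).
  have s_gt0 := odd_gt0 odd_s.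
  have [Sm Sp] : S (s - 1) /\ S (s + 1).
    by split; apply: (coe s) => //=; [left|right].
  rewrite nE => -[->|->]; first by rewrite -addnBA //; apply: T_translate.
  by rewrite -addnA; apply: T_translate.
Qed.

Lemma translate_maximal_embedding_dimension : maximal_embedding_dimension T.
Proof.
have [[[S0 SD] finS] _] := coeS.
have [[mT /cofinite_nat[N TN]] _] := translate_coe_semigroup.
have Tx : (T `\ 0) x by split; [rewrite -[x]addn0; apply: T_translate|case: Sx].
have multT : multiplicity T = x.
  by apply: multiplicity_eq => // n /T_positive[s _ ->]; apply: leq_addr.
apply/(maximal_embedding_dimensionP _ _ mT Tx multT) => r rx.
have exa : exists a, `[< (T `\ 0) a >] && (a %% x == r).
  (* The factor [N.+1] puts the witness beyond [N] and keeps it positive even when [r = 0]. *)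
  exists (N.+1 * x + r); rewrite modnMDl modn_small // eqxx andbT.
  apply/asboolP; split; [by apply: TN; nia|apply/eqP; nia].
have [a /andP[/asboolP Ta /eqP ar] min_a] := ex_minnP exa.
exists a => //; split=> // -[_ /T_positive[s Ss ->]] [_ /T_positive[t St ->]] aE.
(* Dropping the last [x] leaves a smaller positive element of [T] in the same class, against the
   minimality of [a]. *)
have aE' : a = x + (s + t) + x by lia.
suff /min_a : `[< (T `\ 0) (x + (s + t)) >] && ((x + (s + t)) %% x == r) by lia.
rewrite -ar aE' modnDr eqxx andbT; apply/asboolP; split.
  by apply: T_translate; apply: SD.
by apply/eqP; lia.
Qed.

End Translate.

(** * Converse: shifting down by the multiplicity *)

Lemma coe_multiplicity_even (T : set nat) :
  coe_semigroup T -> T <> [set: nat] -> ~~ odd (multiplicity T).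
Proof.
move=> [nT coe] TN; have [[Tm m0] lb] := multiplicity_spec _ nT.
apply/negP => odd_m; apply: TN; apply/seteqP; split=> // n _.
have Tm1 : T (multiplicity T - 1) by apply: (coe _ odd_m Tm); left.
have m1 : multiplicity T = 1.
  apply: contrapT => m1; have : multiplicity T <= multiplicity T - 1.
    by apply: lb; split=> //=; lia.
  by move: (odd_gt0 odd_m); lia.
by rewrite -(muln1 n); apply: submonoid_muln; [case: nT|rewrite -m1].
Qed.

Lemma maximal_embedding_dimension_subm (T : set nat) (s t : nat) :
    numerical_semigroup T -> maximal_embedding_dimension T ->
    (T `\ 0) s -> (T `\ 0) t ->
  (T `\ 0) (s + t - multiplicity T).
Proof.
move=> nT medT Ts Tt; have [mT _] := nT; have [Tm lb] := multiplicity_spec _ nT.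
have [_ TD] := mT; set m := multiplicity T in Tm lb *.
have m_gt0 : 0 < m by case: Tm => _ /= /eqP; lia.
have Tst : (T `\ 0) (s + t).
  by split; [apply: TD; [case: Ts|case: Tt]|case: Ts => _ /=; lia].
have /(_ ((s + t) %% m))[|a irr_a amod] :=
  (maximal_embedding_dimensionP _ _ mT Tm erefl).1 medT; first by rewrite ltn_mod.
have [[Ta a0] _] := irr_a.
have le_ast := irreducible_mod_leq _ _ _ _ mT Tm irr_a Tst amod.
have [k stE] := eqn_mod_leq_ex _ _ _ le_ast amod.
(* For [k = 0] the reducible [s + t] would be the irreducible [a]; otherwise one copy of [m] can be
   removed. *)
case: k stE => [|k] stE.
  case: irr_a => _ []; exists s => //; exists t => //.
  by rewrite stE mul0n addn0.
have -> : s + t - m = a + k * m by rewrite stE mulSn; lia.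
split; last by move: a0 => /=; lia.
by apply: TD => //; apply: submonoid_muln => //; case: Tm.
Qed.

Theorem proposition41 :
  (forall (S : set nat) (x : nat),
     coe_semigroup S -> (S `\ 0) x -> ~~ odd x ->
     coe_semigroup (sumset [set x] S `|` [set 0]) /\
     maximal_embedding_dimension (sumset [set x] S `|` [set 0])) /\
  (forall T : set nat,
     coe_semigroup T -> maximal_embedding_dimension T -> T <> [set: nat] ->
     exists (S : set nat) (x : nat),
       [/\ coe_semigroup S, (S `\ 0) x, ~~ odd x &
           T = sumset [set x] S `|` [set 0]]).
Proof.
split=> [S x coeS Sx x_even|T coeT medT TN].
  split; first exact: translate_coe_semigroup.
  exact: translate_maximal_embedding_dimension.
have m_even := coe_multiplicity_even _ coeT TN.
have [nT coe] := coeT; have [[T0 TD] finT] := nT.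
have [[Tm m0] lb] := multiplicity_spec _ nT.
have subm := maximal_embedding_dimension_subm _ _ _ nT medT.
set m := multiplicity T in m_even Tm m0 lb subm.
have m_gt1 : 1 < m by move: m0 m_even => /=; case: (m) => [|[]].
have nz n : T (m + n) -> (T `\ 0) (m + n) by split=> //=; lia.
(* This set is [T] without 0, shifted down by [m]: as [m] is positive, [m + n] is never 0. *)
exists [set n | T (m + n)], m; split=> //.
- split; first split.
  + split=> [|a b /= Ta Tb]; first by rewrite /= addn0.
    have -> : m + (a + b) = (m + a) + (m + b) - m by lia.
    by have [] := subm _ _ (nz _ Ta) (nz _ Tb).
  + have [N TN'] := cofinite_nat _ finT.
    apply: sub_finite_set (finite_II N) => n /= nTn; rewrite ltnNge.
    by apply/negP => Nn; apply: nTn; apply: TN'; lia.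
  + move=> n odd_n /= Tn y; have n_gt0 := odd_gt0 odd_n.
    have odd_mn : odd (m + n) by rewrite oddD (negbTE m_even).
    have coe_mn := coe _ odd_mn Tn.
    move=> [->|->] /=; apply: coe_mn; last by right; rewrite /= addnA.
    by left; rewrite /= addnBA.
(* Membership of [m] in the shifted set means that [m + m] is in [T]. *)
- by split=> //=; apply: TD.
- apply/seteqP; split=> n.
    have [->|/eqP n0] := eqVneq n 0; first by right.
    move=> Tn; have mn : m <= n by apply: lb.
    by left; exists m => //; exists (n - m); rewrite /= subnKC.
  by move=> [[_ -> [s Ts <-]]|->].
Qed.
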